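(* Let $q\ge 1$ be an integer, let $G$ be a simple connected graph with $n$ nodes and $m$ edges, and let $S_q(G)$ be the $q$-subdivision graph of $G$ with node set $\hat V=V\cup V'$. Let $r_{ij}$ and $\hat r_{ij}$ denote resistance distances in $G$ and in $S_q(G)$, respectively. Then: (1) for $i,j\in V$, $\hat{r}_{ij}=\frac{2}{q}r_{ij}$; (2) for $i\in V'$, $j\in V$ and $\hat{\Gamma}(i)=\{s,t\}$, $$\hat{r}_{ij}=\frac{1}{2}+\frac{2r_{sj}+2r_{tj}-r_{st}}{2q};$$ (3) for $i,j\in V'$ with $i\neq j$, $\hat{\Gamma}(i)=\{s,t\}$ and $\hat{\Gamma}(j)=\{u,v\}$, $$\hat{r}_{ij}=1+\frac{r_{su}+r_{tu}+r_{sv}+r_{tv}-r_{st}-r_{uv}}{2q}.$$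
   Context: The $q$-subdivision graph $S_q(G)$ is obtained from $G$ by replacing each edge $uv$ with $q$ disjoint paths of length $2$: $ux_1v,\ldots,ux_qv$. $V=V(G)$ is the set of old nodes, $V'$ the set of $mq$ new nodes, and for $i\in V'$, $\hat\Gamma(i)$ is the set of neighbors of $i$ in $S_q(G)$, i.e. the two end nodes of the edge of $G$ that produced $i$. The resistance distance $r_{ij}$ between nodes $i,j$ of a connected graph is the effective resistance between $i$ and $j$ in the electrical network obtained by replacing each edge with a unit resistor; $r_{ii}=0$. *)

(* Defs.v *)
From HB Require Import structures.
From mathcomp Require Import all_boot all_order all_algebra.
From mathcomp Require Import boolp classical_sets.
Set Implicit Arguments.
Unset Strict Implicit.
Unset Printing Implicit Defensive.
Import Order.TTheory GRing.Theory Num.Theory.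
Local Open Scope ring_scope.

(* A simple graph on the node set T is a symmetric irreflexive e : rel T.     *)

Definition connected_graph (T : finType) (e : rel T) : Prop :=
  forall x y : T, connect e x y.

Definition edges (T : finType) (e : rel T) : {set {set T}} :=
  [set [set p.1; p.2]%SET | p : T * T & e p.1 p.2]%SET.

Definition neighbors (T : finType) (e : rel T) (x : T) : {set T} :=
  [set y | e x y]%SET.

Definition new_node (T : finType) (e : rel T) (q : nat) : finType :=
  ({A : {set T} | A \in edges e} * 'I_q)%type.

(* (A, k) is the middle node x_k of the k-th path u x_k v replacing the edge  *)
(* A = {u, v}.                                                                *)
Definition subdiv_node (T : finType) (e : rel T) (q : nat) : finType :=
  (T + new_node e q)%type.

Definition subdiv_rel (T : finType) (e : rel T) (q : nat) :
    rel (subdiv_node e q) :=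
  fun a b => match a, b with
  | inl u, inr i => u \in val i.1
  | inr i, inl u => u \in val i.1
  | _, _ => false
  end.

(* v is the potential when every edge is a unit resistor and a unit current   *)
(* enters at i and leaves at j: by Ohm's law the current from x to y is       *)
(* v x - v y, and Kirchhoff's current law holds at every node.                *)
Definition unit_current_potential (R : realFieldType) (T : finType)
    (e : rel T) (i j : T) (v : T -> R) : Prop :=
  forall x : T,
    \sum_(y : T | e x y) (v x - v y) = (x == i)%:R - (x == j)%:R.

(* The potential difference between i and j for such a v. On a connected      *)
(* graph v exists and the difference does not depend on it, see               *)
(* unit_current_potential_ex and resistanceP; 0 is a dummy value otherwise.   *)
Definition resistance (R : realFieldType) (T : finType) (e : rel T)
    (i j : T) : R :=
  xget 0 [set r | exists2 v : T -> R,
                    unit_current_potential e i j v & r = v i - v j]%classic.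

Section WellDefined.
Variables (R : realFieldType) (T : finType) (e : rel T).
Hypotheses (esym : symmetric e) (econ : connected_graph e).

Lemma harmonic_const (w : T -> R) :
  (forall x, \sum_(y | e x y) (w x - w y) = 0) -> forall x y, w x = w y.
Proof.
move=> hw.
have E0 : \sum_x \sum_(y | e x y) (w x - w y) ^+ 2 = 0.
  have h1 : \sum_x \sum_(y | e x y) w x * (w x - w y) = 0.
    by apply: big1 => x _; rewrite -mulr_sumr hw mulr0.
  have h2 : \sum_x \sum_(y | e x y) w y * (w x - w y) = 0.
    rewrite (exchange_big_dep predT) //=; apply: big1 => y _.
    rewrite -mulr_sumr (eq_bigl (fun x => e y x)); last first.
      by move=> x; apply: esym.
    rewrite (eq_bigr (fun x => - (w y - w x))) => [|x _]; last by rewrite opprB.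
    by rewrite sumrN hw oppr0 mulr0.
  transitivity (\sum_x \sum_(y | e x y) w x * (w x - w y)
                - \sum_x \sum_(y | e x y) w y * (w x - w y)).
    rewrite -sumrB; apply: eq_bigr => x _; rewrite -sumrB.
    by apply: eq_bigr => y _; rewrite expr2 -mulrBl.
  by rewrite h1 h2 subrr.
have estep x y : e x y -> w x = w y.
  move=> exy; apply/eqP; rewrite -subr_eq0 -sqrf_eq0; apply/eqP.
  have ge0 z : 0 <= \sum_(t | e z t) (w z - w t) ^+ 2.
    by apply: sumr_ge0 => t _; rewrite sqr_ge0.
  have /psumr_eq0P hx := E0.
  have /psumr_eq0P hy := hx (fun z _ => ge0 z) x isT.
  by apply: hy => // t _; rewrite sqr_ge0.
move=> x y; have /connectP [p pp ->] := econ x y.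
elim: p x pp => //= z p IHp x /andP[exz pz].
by rewrite (estep _ _ exz); apply: IHp.
Qed.

Lemma unit_current_potential_ex (i j : T) :
  exists v : T -> R, unit_current_potential e i j v.
Proof.
pose n := #|T|.
pose L : 'M[R]_n := \matrix_(a, b)
  ((a == b)%:R * \sum_(y | e (enum_val a) y) 1
   - (e (enum_val a) (enum_val b))%:R).
have LE (w : T -> R) (x : T) :
    \sum_b L (enum_rank x) b * w (enum_val b) = \sum_(y | e x y) (w x - w y).
  under eq_bigr => b _ do rewrite mxE enum_rankK mulrBl.
  rewrite sumrB (bigD1 (enum_rank x)) //= eqxx mul1r enum_rankK.
  rewrite [X in _ + X - _]big1 ?addr0.
    rewrite sumrB mulr_suml; congr (_ - _).
      by apply: eq_bigr => y _; rewrite mul1r.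
    rewrite [RHS]big_mkcond (reindex (@enum_val T T)) /=; last first.
      by apply: onW_bij; apply: enum_val_bij.
    by apply: eq_bigr => b _; case: (e x _); rewrite ?mul1r ?mul0r.
  by move=> b; rewrite eq_sym => /negbTE->; rewrite !mul0r.
have LT a b : L a b = L b a.
  rewrite !mxE [b == a]eq_sym.
  rewrite [e (enum_val b) _]esym.
  by case: (a =P b) => [->//|_]; rewrite !mul0r.
pose u : 'rV[R]_n := \row_a ((enum_val a == i)%:R - (enum_val a == j)%:R).
have uL : (u <= L)%MS.
  rewrite submxE; apply/eqP/matrixP => a c; rewrite !mxE.
  have hc x y : cokermx L (enum_rank x) c = cokermx L (enum_rank y) c.
    apply: (@harmonic_const (fun z => cokermx L (enum_rank z) c)) => z.
    rewrite -LE; have /matrixP/(_ (enum_rank z) c) := mulmx_coker L.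
    rewrite mxE [RHS]mxE => hz; rewrite -[RHS]hz; apply: eq_bigr => b _.
    by rewrite enum_valK.
  rewrite (eq_bigr (fun b => u a b * cokermx L (enum_rank i) c)); last first.
    by move=> b _; rewrite -(hc (enum_val b) i) enum_valK.
  rewrite -mulr_suml; under eq_bigr => b _ do rewrite mxE.
  have S1 k : \sum_(b : 'I_n) ((enum_val b == k)%:R : R) = 1.
    rewrite (bigD1 (enum_rank k)) //= enum_rankK eqxx big1 ?addr0 // => b.
    by case: (enum_val b =P k) => // <-; rewrite enum_valK eqxx.
  by rewrite sumrB !S1 subrr mul0r.
pose v : 'rV[R]_n := u *m pinvmx L.
exists (fun x => v 0 (enum_rank x)) => x.
rewrite -LE.
have /matrixP/(_ 0 (enum_rank x)) := mulmxKpV uL.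
rewrite mxE [RHS]mxE enum_rankK => <-; apply: eq_bigr => b _.
by rewrite enum_valK mulrC LT.
Qed.

Lemma resistanceP (i j : T) (v : T -> R) :
  unit_current_potential e i j v -> resistance R e i j = v i - v j.
Proof.
move=> hv; apply: xget_unique; first by exists v.
move=> r [v' hv' ->].
have hc : v' i - v i = v' j - v j.
  apply: (@harmonic_const (fun x => v' x - v x)) => x.
  transitivity (\sum_(y | e x y) (v' x - v' y) - \sum_(y | e x y) (v x - v y)).
    rewrite -sumrB; apply: eq_bigr => y _.
    by rewrite !opprB addrACA [RHS]addrACA [- v x - _]addrC.
  by rewrite hv hv' subrr.
have -> : v' i = v' j - v j + v i by rewrite -hc subrK.
by rewrite addrAC [_ - v j - _]addrAC subrr add0r addrC.
Qed.

End WellDefined.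

(* Main.v *)
Require Import Defs.
From mathcomp Require Import all_boot all_order all_algebra.
From mathcomp Require Import boolp ring.
Set Implicit Arguments.
Unset Strict Implicit.
Unset Printing Implicit Defensive.
Import Order.TTheory GRing.Theory Num.Theory.
Local Open Scope ring_scope.

(** Let a unit current enter the network S_q(G) at a new node with end nodes s
    and t. By superposition, the flow on the two half-edges at that node is one
    half towards each end, plus a flow passing through between s and t. Seen
    from the old nodes the injection is therefore a source of strength 1/2 at s
    and 1/2 at t; an old node is the degenerate case with a single end. The q paths
    of length 2 along an edge of G act as one resistor of value 2/q. So a
    potential p on G for the current which enters evenly through the ends of a
    and leaves evenly through the ends of b becomes a potential for the unit
    current from a to b in S_q(G): scale p by 2/q, give a new node the average
    over its two ends, and correct it by 1/2 (resp. -1/2) if it is a (resp. b)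
    ([lift_unit_current]).

    What remains is the voltage of p between the ends of a and those of b. For
    a charge c of total 0 on G whose potential is p, the energy
    \sum_x c x * p x equals
    - 1/2 \sum_x \sum_y c x * c y * r x y. Here c is a difference of two
    uniform distributions, so the energy is rr a b - rr a a / 2 - rr b b / 2,
    where rr c d is the average of r over the ends of c and those of d. It is
    computed by writing both p and r through one Green function g
    ([resistance_green], [mean_resistance]).
    The result, [subdiv_resistance], is one formula for all distinct nodes a and
    b; the three parts of the theorem are its instances for two old nodes, a new
    and an old node, and two new nodes. *)

(** * Averages over finite sets *)

Section Mean.
Variables (R : realFieldType) (T : finType).
Implicit Types (A B : {set T}) (f : T -> R).

Definition mean A f : R := (\sum_(x in A) f x) / #|A|%:R.

Lemma eq_mean A f1 f2 : f1 =1 f2 -> mean A f1 = mean A f2.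
Proof. by move=> h; congr (_ / _); apply: eq_bigr. Qed.

Lemma meanB A f1 f2 : mean A (fun x => f1 x - f2 x) = mean A f1 - mean A f2.
Proof. by rewrite /mean sumrB mulrBl. Qed.

Lemma mean_sum (I : finType) (P : pred I) A (F : I -> T -> R) :
  mean A (fun x => \sum_(i | P i) F i x) = \sum_(i | P i) mean A (F i).
Proof. by rewrite /mean exchange_big mulr_suml. Qed.

Lemma mean_const A (c : R) : A != set0 -> mean A (fun=> c) = c.
Proof.
by rewrite -card_gt0 => A0; rewrite /mean sumr_const -[c *+ _]mulr_natr mulfK
  // pnatr_eq0 -lt0n.
Qed.

Lemma mean1 x f : mean [set x] f = f x.
Proof. by rewrite /mean big_set1 cards1 divr1. Qed.

Lemma mean2 x y f : x != y -> mean [set x; y] f = (f x + f y) / 2.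
Proof. by move=> xy; rewrite /mean big_setU1 ?inE //= big_set1 cards2 xy. Qed.

Lemma mean_indicator A x : mean A (fun y => (x == y)%:R) = (x \in A)%:R / #|A|%:R.
Proof.
rewrite /mean; congr (_ / _); case: (boolP (x \in A)) => xA.
  rewrite (bigD1 x) //= eqxx big1 ?addr0 // => y /andP[_ /negbTE yx].
  by rewrite eq_sym yx.
by apply: big1 => y yA; case: eqP => // xy; rewrite xy yA in xA.
Qed.

Lemma exchange_mean A B (F : T -> T -> R) :
  mean A (fun x => mean B (F x)) = mean B (fun y => mean A (F^~ y)).
Proof. by rewrite /mean -!mulr_suml exchange_big mulrAC. Qed.

End Mean.

(** * Green functions and resistances *)

Section Green.
Variables (R : realFieldType) (T : finType) (e : rel T).
Hypotheses (esym : symmetric e) (econ : connected_graph e).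

(** g i is the potential of a unit source at i, drained through a fixed
    background k, which cancels in every difference of two sources. *)
Definition green (g : T -> T -> R) (k : T -> R) : Prop :=
  forall i x, \sum_(y | e x y) (g i x - g i y) = (x == i)%:R - k x.

(** Ground one node and let every source drain there. *)
Lemma green_ex : exists g k, green g k.
Proof.
case: (pickP (@predT T)) => [x0 _|T0]; last first.
  by exists (fun _ _ => 0), (fun=> 0) => i; move: (T0 i).
have [g hg] := choice (fun i => unit_current_potential_ex R esym econ i x0).
by exists g, (fun x => (x == x0)%:R).
Qed.

Lemma resistance_green g k i j : green g k ->
  resistance R e i j = g i i - g j i - (g i j - g j j).
Proof.
move=> gg; apply: (resistanceP esym econ (v := fun x => g i x - g j x)) => x.
rewrite (eq_bigr (fun y => (g i x - g i y) - (g j x - g j y))) => [|y _];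
  last by ring.
by rewrite sumrB !gg; ring.
Qed.

Lemma resistancexx i : resistance R e i i = 0.
Proof. by have [g [k gg]] := green_ex; rewrite (resistance_green _ _ gg); ring. Qed.

Lemma resistanceC i j : resistance R e i j = resistance R e j i.
Proof. by have [g [k gg]] := green_ex; rewrite !(resistance_green _ _ gg); ring. Qed.

(** Averaging r x y = g x x + g y y - g x y - g y x; for A = B the diagonal
    terms are those that rr a a / 2 and rr b b / 2 later remove from rr a b. *)
Lemma mean_resistance g k A B : green g k -> A != set0 -> B != set0 ->
  mean A (fun x => mean B (fun y => resistance R e x y)) =
    mean A (fun x => g x x) + mean B (fun y => g y y)
    - mean A (fun x => mean B (g x)) - mean B (fun x => mean A (g x)).
Proof.
move=> gg A0 B0.
transitivity (mean A (fun x => g x x - mean B (fun y => g y x)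
                                - (mean B (g x) - mean B (fun y => g y y)))).
  apply: eq_mean => x; under eq_mean => y do rewrite (resistance_green _ _ gg).
  by rewrite !meanB mean_const.
by rewrite !meanB (exchange_mean A) mean_const //; ring.
Qed.

End Green.

(** * The subdivision graph *)

Section Subdivision.
Variables (R : realFieldType) (q : nat) (T : finType) (e : rel T).
Hypotheses (hq : (1 <= q)%N) (esym : symmetric e) (eirr : irreflexive e)
  (econ : connected_graph e).
Let S := subdiv_node e q.
Local Notation se := (@subdiv_rel T e q).

(** The old nodes at which a current injected at a node is felt. *)
Definition ends (a : S) : {set T} :=
  match a with inl x => [set x] | inr k => val k.1 end.

Definition is_new (a : S) : bool := if a is inr _ then true else false.

Lemma edge_neq x y : e x y -> x != y.
Proof. by apply: contraTneq => ->; rewrite eirr. Qed.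

Lemma edge_set x y : e x y -> [set x; y] \in edges e.
Proof. by move=> exy; apply/imsetP; exists (x, y); rewrite ?inE. Qed.

Lemma edgesP (A : {set T}) :
  A \in edges e -> exists x y, e x y /\ A = [set x; y].
Proof. by case/imsetP=> -[x y]; rewrite inE => exy ->; exists x, y. Qed.

Lemma edge_card (A : {set T}) : A \in edges e -> #|A| = 2.
Proof. by case/edgesP=> x [y [exy ->]]; rewrite cards2 (edge_neq exy). Qed.

Lemma ends_neq0 a : ends a != set0.
Proof.
rewrite -card_gt0; case: a => [x|[[A hA] k]] /=; first by rewrite cards1.
by rewrite edge_card.
Qed.

Lemma subdiv_sym : symmetric se.
Proof. by case=> [x|k] [y|l]. Qed.

Lemma subdiv_connected : connected_graph se.
Proof.
have cC : connect_sym se by apply: sym_connect_sym; apply: subdiv_sym.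
have step x y : e x y -> connect se (inl x) (inl y).
  move=> exy; pose k : new_node e q :=
    (exist (fun A => A \in edges e) _ (edge_set exy), Ordinal hq).
  by apply: (@connect_trans _ _ (inr k)); apply: connect1;
    rewrite /= !inE eqxx ?orbT.
have old x y : connect se (inl x) (inl y).
  have /connectP [p pp ->] := econ x y.
  elim: p x pp => //= z p IHp x /andP[exz pz].
  exact: connect_trans (step _ _ exz) (IHp _ pz).
have near a : exists x, connect se a (inl x).
  case: a => [x|k]; first by exists x.
  have /set0Pn[x xk] := ends_neq0 (inr k).
  by exists x; apply: connect1.
move=> a b; have [x ax] := near a; have [y by_] := near b.
by apply: connect_trans ax (connect_trans (old x y) _); rewrite cC.
Qed.

(** Kirchhoff's law at an old node x of S_q(G) is a sum over the new nodes
    attached to x; this turns it into a sum over the neighbours of x in G, each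
    edge being counted once per parallel path. *)
Lemma sum_incident (F : {set T} -> R) x :
  \sum_(k : new_node e q | x \in val k.1) F (val k.1)
    = q%:R * \sum_(y | e x y) F [set x; y].
Proof.
transitivity (\sum_(A : {A : {set T} | A \in edges e} | x \in val A)
                \sum_(k < q) F (val A)).
  by rewrite pair_big; apply: eq_bigl => k; rewrite andbT.
under eq_bigr do rewrite sumr_const card_ord -[F _ *+ _]mulr_natl.
rewrite -mulr_sumr; congr (_ * _).
rewrite -(big_sub_cond (mem (edges e)) (fun A => x \in A) F).
transitivity (\sum_(A in [set [set x; y] | y in neighbors e x]) F A).
  apply: eq_bigl => A; apply/andP/imsetP.
    move=> [/edgesP[u [v [euv ->]]]]; rewrite !inE => /orP[]/eqP->.
      by exists v; rewrite ?inE.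
    by exists u; rewrite ?inE 1?esym // setUC.
  by move=> [y]; rewrite inE => exy ->; rewrite edge_set // !inE eqxx.
rewrite big_imset /=; first by apply: eq_bigl => y; rewrite inE.
move=> y z; rewrite !inE => exy exz E.
(* The edge {x, y} determines y because y differs from x. *)
have: y \in [set x; z] by rewrite -E !inE eqxx orbT.
by rewrite !inE => /orP[]/eqP // yx; rewrite yx eirr in exy.
Qed.

(** The factor 2 / q is the resistance of q parallel paths of length 2. A new
    node absorbing or emitting no current sits at the average of its ends; an
    injected unit current leaves it over two parallel unit resistors, which
    raises its potential by 1/2. *)
Definition lift (p : T -> R) (a b z : S) : R :=
  2 / q%:R * mean (ends z) p
    + (is_new z)%:R * ((z == a)%:R - (z == b)%:R) / 2.

(** Of a unit injected at a, the old node x gets its share in the uniform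
    distribution on the ends of a. For a new node a this share arrives through
    a half-edge; for an old node it is the direct injection, subtracted here. *)
Lemma sum_half_indicator (a : S) x :
  \sum_(k : new_node e q | x \in val k.1) (inr k == a :> S)%:R / 2
    = mean (ends a) (fun y => (x == y)%:R) - (inl x == a :> S)%:R :> R.
Proof.
rewrite mean_indicator; case: a => [y|k] /=.
  rewrite big1 => [|k _]; last by rewrite mul0r.
  by rewrite inE cards1 divr1 -[X in _ - X]/((x == y)%:R) subrr.
rewrite (edge_card (valP k.1)) subr0.
rewrite big_mkcond (bigD1 k) //= eqxx big1 ?addr0; last first.
  move=> l lk; case: (inr l =P inr k) => [[E]|_]; last by rewrite mul0r if_same.
  by rewrite E eqxx in lk.
by case: ifP; rewrite ?mul0r.
Qed.

Lemma lift_unit_current (p : T -> R) (a b : S) :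
  (forall x, \sum_(y | e x y) (p x - p y) =
     mean (ends a) (fun y => (x == y)%:R) - mean (ends b) (fun y => (x == y)%:R)) ->
  unit_current_potential se a b (lift p a b).
Proof.
have q0 : q%:R != 0 :> R by rewrite pnatr_eq0 -lt0n.
move=> hp [x|k]; rewrite big_sumType /= ?big_pred0_eq ?add0r ?addr0.
  (* The current from x into the new node k is F of its edge, minus the share
     of the current injected at k which flows back to x. *)
  pose F (A : {set T}) := 2 / q%:R * (p x - mean A p).
  rewrite (eq_bigr (fun k : new_node e q => F (val k.1)
     - ((inr k == a :> S)%:R / 2 - (inr k == b :> S)%:R / 2))); last first.
    move=> k _; rewrite /lift /F /= mean1.
    by move: (_ == a) (_ == b) (mean _ _) => da db m; field.
  rewrite sumrB sum_incident sumrB !sum_half_indicator.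
  rewrite (eq_bigr (fun y => q%:R^-1 * (p x - p y))); last first.
    by move=> y exy; rewrite /F mean2 ?edge_neq //; field.
  rewrite -mulr_sumr hp.
  by move: (_ == a) (_ == b) (mean (ends a) _) (mean (ends b) _) => *; field.
have [s [t [est E]]] := edgesP (valP k.1).
rewrite /lift /= E big_setU1 ?inE ?edge_neq //= big_set1 !mean1.
rewrite mean2 ?edge_neq // !mul0r.
by move: (_ == a) (_ == b) => da db; field.
Qed.

(** The term with is_new is the voltage of 1/2 between a new node among a, b
    and the average of its two ends, caused by the current injected there; the
    rest is 2 / q times the energy in G of the current from the ends of a to
    those of b, written through the resistances of G. *)
Lemma subdiv_resistance (a b : S) : a != b ->
  let rr c d := mean (ends c) (fun x => mean (ends d) (resistance R e x)) in
  resistance R se a b = ((is_new a)%:R + (is_new b)%:R) / 2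
    + 2 / q%:R * (rr a b - rr a a / 2 - rr b b / 2).
Proof.
move=> ab rr; have q0 : q%:R != 0 :> R by rewrite pnatr_eq0 -lt0n.
have [g [k gg]] := green_ex R esym econ.
(* Superposition: the Green functions of the ends of a minus those of b. *)
pose p y := mean (ends a) (g^~ y) - mean (ends b) (g^~ y).
have hp x : \sum_(y | e x y) (p x - p y) =
     mean (ends a) (fun y => (x == y)%:R) - mean (ends b) (fun y => (x == y)%:R).
  have hm c : \sum_(y | e x y) (mean (ends c) (g^~ x) - mean (ends c) (g^~ y))
            = mean (ends c) (fun y => (x == y)%:R) - k x.
    rewrite -[k x](mean_const _ (ends_neq0 c)) -meanB.
    under eq_bigr do rewrite -meanB.
    by rewrite -mean_sum; apply: eq_mean => i; rewrite gg.
  rewrite (eq_bigr (fun y =>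
     (mean (ends a) (g^~ x) - mean (ends a) (g^~ y))
     - (mean (ends b) (g^~ x) - mean (ends b) (g^~ y)))) => [|y _].
    by rewrite sumrB !hm; ring.
  by rewrite /p; ring.
rewrite (resistanceP subdiv_sym subdiv_connected (lift_unit_current hp)).
rewrite /rr !(mean_resistance esym econ gg) ?ends_neq0 //.
rewrite /lift !eqxx (negbTE ab) [b == a]eq_sym (negbTE ab) /p !meanB.
have exch A B : mean A (fun y => mean B (g^~ y)) = mean B (fun x => mean A (g x)).
  exact: exchange_mean.
by rewrite !exch /=; field.
Qed.

(** s and t are distinct because an edge of a loopless graph has two ends. *)
Lemma ends_nbr (k : new_node e q) s t :
  neighbors se (inr k) = [set inl s; inl t] ->
  s != t /\ ends (inr k) = [set s; t].
Proof.
move=> E; have Ek : ends (inr k) = [set s; t].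
  by apply/setP=> x; move/setP/(_ (inl x)): E; rewrite !inE.
split=> //; have := edge_card (valP k.1); rewrite -[val _]/(ends (inr k)) Ek.
by rewrite cards2; case: eqP.
Qed.

End Subdivision.

(** * Resistance distances in the subdivision graph *)

Theorem theorem6p1 (R : realFieldType) (q : nat) (T : finType) (e : rel T)
    (hq : (1 <= q)%N) (esym : symmetric e) (eirr : irreflexive e)
    (econ : connected_graph e) :
  let r : T -> T -> R := resistance R e in
  let r' : subdiv_node e q -> subdiv_node e q -> R :=
    resistance R (@subdiv_rel T e q) in
  let nbr : new_node e q -> {set subdiv_node e q} :=
    fun i => neighbors (@subdiv_rel T e q) (inr i) in
  [/\ forall i j : T, r' (inl i) (inl j) = 2 / q%:R * r i j,
      forall (i : new_node e q) (j s t : T),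
        nbr i = [set inl s; inl t] ->
        r' (inr i) (inl j) =
          1 / 2 + (2 * r s j + 2 * r t j - r s t) / (2 * q%:R)
    & forall (i j : new_node e q) (s t u v : T),
        i != j ->
        nbr i = [set inl s; inl t] ->
        nbr j = [set inl u; inl v] ->
        r' (inr i) (inr j) =
          1 + (r s u + r t u + r s v + r t v - r s t - r u v) / (2 * q%:R)].
Proof.
have q0 : q%:R != 0 :> R by rewrite pnatr_eq0 -lt0n.
have rxx := resistancexx R esym econ.
have rC := resistanceC R esym econ.
have rS := subdiv_resistance R hq esym eirr econ.
move=> r r' nbr; split.
- move=> i j; rewrite /r' /r; have [->|ij] := eqVneq i j.
    rewrite rxx mulr0 resistancexx //; first exact: subdiv_sym.
    exact: subdiv_connected.
  by rewrite rS //= !mean1 !rxx; field.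
- move=> i j s t /(ends_nbr eirr)[st Ei]; rewrite /r' rS // Ei.
  by rewrite /= !mean1 !mean2 // !mean1 !rxx (rC t s) /r; field.
- move=> i j s t u v ij /(ends_nbr eirr)[st Ei] /(ends_nbr eirr)[uv Ej].
  rewrite /r' rS // Ei Ej /= !mean2 // !rxx (rC t s) (rC v u) /r.
  by field.
Qed.
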